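(* Let $c$ be a fixed number with $c \geq 3$. If $G$ is a graph such that $\operatorname{mad}(G) < 4 - \frac{4}{c+1} - \epsilon$ for some $\epsilon$ with $\frac{4}{c(c+1)} > \epsilon > 0$, then $$\chi^2_\ell(G) \leq \max\{\Delta(G) + c,\ 16c^2\epsilon^{-2}\}.$$
   Context: Graphs are finite and simple. For a graph $G$, $G^2$ denotes the graph with $V(G^2)=V(G)$ in which distinct vertices $x,y$ are adjacent iff $d_G(x,y)\le 2$ (i.e. $E(G^2)=E(G)\cup\{uw: u\neq w,\ N(u)\cap N(w)\neq\emptyset\}$). $\chi^2_\ell(G)$ denotes $\chi_\ell(G^2)$, the list chromatic number (choice number) of $G^2$. $\Delta(G)$ is the maximum degree of $G$. The maximum average degree $\operatorname{mad}(G)$ is the maximum of $2e(H)/n(H)$ over all non-empty subgraphs $H$ of $G$, where $e(H)=|E(H)|$ and $n(H)=|V(H)|$. *)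

(* Defs.v *)
From mathcomp Require Import all_boot all_order all_algebra.
From mathcomp Require Import boolp reals.

Set Implicit Arguments.
Unset Strict Implicit.
Unset Printing Implicit Defensive.

Import Order.TTheory GRing.Theory Num.Theory.

Local Open Scope ring_scope.

Record sgraph := SGraph {
  vertex :> finType;
  adj : rel vertex;
  adj_sym : symmetric adj;
  adj_irrefl : irreflexive adj }.

Definition neighbours (G : sgraph) (x : G) : {set G} := [set y | adj x y].

Definition edges (G : sgraph) : {set {set G}} :=
  [set [set x; y] | x in G, y in neighbours x].

Definition max_degree (G : sgraph) : nat := \max_(x : G) #|neighbours x|.

Section Square.
Variable G : sgraph.

Definition square_adj : rel G := fun x y =>
  (x != y) && (adj x y || (neighbours x :&: neighbours y != set0)).

Lemma square_adj_sym : symmetric square_adj.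
Proof. by move=> x y; rewrite /square_adj eq_sym adj_sym setIC. Qed.

Lemma square_adj_irrefl : irreflexive square_adj.
Proof. by move=> x; rewrite /square_adj eqxx. Qed.

Definition square : sgraph := SGraph square_adj_sym square_adj_irrefl.

End Square.

(* A not necessarily induced subgraph, as a pair (vertex set, edge set). *)
Definition is_subgraph (G : sgraph) (H : {set G} * {set {set G}}) : bool :=
  (H.2 \subset edges G) && [forall e in H.2, e \subset H.1].

(* All the quotients are nonnegative, so starting the maximum at 0 matters only
   for the graph without vertices, which has no non-empty subgraph. *)
Definition mad (R : realType) (G : sgraph) : R :=
  \big[Num.max/0]_(H : {set G} * {set {set G}}
                     | is_subgraph H && (H.1 != set0))
     (2 * #|H.2|%:R / #|H.1|%:R).

Definition choosable (G : sgraph) (k : nat) : Prop :=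
  forall (C : finType) (L : G -> {set C}), (forall x, k <= #|L x|)%N ->
    exists f : G -> C,
      (forall x, f x \in L x) /\ (forall x y, adj x y -> f x != f y).

Lemma choosable_card (G : sgraph) : choosable G #|G|.
Proof.
move=> C L hL.
suff [f [fL finj]] : exists f : G -> C, (forall x, f x \in L x) /\ injective f.
  exists f; split=> // x y; apply: contraTneq => /finj ->.
  by rewrite adj_irrefl.
have H (s : seq G) : uniq s -> exists f : G -> C,
    {in s, forall x, f x \in L x} /\ {in s &, injective f}.
  elim: s => [|a s IH] /=.
    move=> _; have [/card0_eq G0|/card_gt0P[a _]] := posnP #|G|.
      have e (x : G) : C by have := G0 x; rewrite inE.
      by exists e.
    have /card_gt0P[c _] : (0 < #|L a|)%N.
      by apply: leq_trans (hL a); apply/card_gt0P; exists a.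
    by exists (fun=> c).
  case/andP=> as_ us; have [f [fL fI]] := IH us.
  have /card_gt0P[c] : (0 < #|L a :\: [set f x | x in s]|)%N.
    have lt_s : (#|[set f x | x in s]| < #|G|)%N.
      apply: leq_ltn_trans (leq_imset_card _ _) _.
      rewrite (card_uniqP us) -[X in (X <= _)%N]/(size (a :: s)).
      have /card_uniqP <- : uniq (a :: s) by rewrite /= as_.
      exact: max_card.
    rewrite cardsD subn_gt0; apply: leq_trans (hL a).
    by apply: leq_ltn_trans lt_s; rewrite subset_leq_card ?subsetIr.
  rewrite inE => /andP[cf cL].
  have cN x : x \in s -> f x != c.
    by move=> xs; apply: contraNneq cf => <-; apply: imset_f.
  have nea x : x \in s -> (x == a) = false.
    by move=> xs; apply: contraNF as_ => /eqP <-.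
  exists (fun x => if x == a then c else f x); split=> [x|x y].
    by rewrite inE; case: eqP => [-> //|_] /= /fL.
  rewrite !inE => /orP[/eqP->|xs] /orP[/eqP->|ys] //; rewrite ?eqxx ?nea //.
  - by move=> e; have := cN _ ys; rewrite -e eqxx.
  - by move=> e; have := cN _ xs; rewrite e eqxx.
  - exact: fI.
have [f [fL fI]] := H _ (enum_uniq G).
by exists f; split=> [x|x y]; [apply: fL | apply: fI]; rewrite mem_enum.
Qed.

Lemma choosable_exists (G : sgraph) : exists k, `[< choosable G k >].
Proof. by exists #|G|; apply/asboolP/choosable_card. Qed.

Definition choice_number (G : sgraph) : nat := ex_minn (choosable_exists G).

(* Main.v *)
(* Let k be the integer part of the bound, and call a vertex light if its degree
   in the square of G is less than k: light vertices can always be coloured last.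
   By induction on the number of edges, we may assume that G has no vertex of
   degree 1 and that a neighbour u of a light vertex sees at least k non-light
   vertices in the square. Discharging then contradicts sparsity. A vertex is
   big if its degree is at least T = 4c/eps; big vertices send 1 - eps/c to each
   neighbour. A small vertex without big neighbours has square degree at most k,
   and shares its excess degree equally. A small vertex v with at least two big
   neighbours can afford everything. If v has exactly one, put a = 2/(c+1): an
   edge from v to a small u is then worth at least a times the number of
   non-light vertices seen through u, unless u is generous; there are at least
   k - Delta > c - 1 of these, and a(c - 1) is just what v needs. *)

Require Import Defs.
From mathcomp Require Import all_boot all_order all_algebra.
From mathcomp Require Import boolp reals.
From mathcomp Require Import ring lra.

Set Implicit Arguments.
Unset Strict Implicit.
Unset Printing Implicit Defensive.

Import Order.TTheory GRing.Theory Num.Theory.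

(** * Greedy list colouring *)

Section GreedyColouring.
Variables (V C : finType) (r : rel V) (L : V -> {set C}) (k : nat).
Hypotheses (r_sym : symmetric r) (r_irrefl : irreflexive r).
Hypothesis hL : forall x, k <= #|L x|.

(** Vertices of [S] count as uncoloured; they keep arbitrary colours from their lists so that [f]
    stays total. *)
Definition colours_off (S : {set V}) (f : V -> C) : Prop :=
  (forall x, f x \in L x) /\
  (forall x y, x \notin S -> y \notin S -> r x y -> f x != f y).

Lemma colour_vertex (S : {set V}) (f : V -> C) (x : V) :
    #|[set y | r x y] :\: S| < k -> colours_off S f ->
  exists g, colours_off (S :\ x) g.
Proof.
move=> ltk [fL fr].
have /card_gt0P[c] : 0 < #|L x :\: [set f y | y in [set y | r x y] :\: S]|.
  rewrite cardsD subn_gt0; apply: leq_trans (hL x).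
  apply: leq_ltn_trans ltk; apply: leq_trans (leq_imset_card f _).
  by rewrite subset_leq_card ?subsetIr.
rewrite inE => /andP[cf cL].
have cN y : y \notin S -> r x y -> f y != c.
  move=> yS rxy; apply: contraNneq cf => <-.
  by apply: imset_f; rewrite !inE yS.
exists (fun z => if z == x then c else f z); split=> [z|y z].
  by case: eqP => [->|].
rewrite !inE !negb_and !negbK.
case: (eqVneq y x) => [->|_] /=; case: (eqVneq z x) => [->|_] //=.
- by rewrite r_irrefl.
- by move=> _ zS /(cN _ zS); rewrite eq_sym.
- by move=> yS _; rewrite r_sym => /(cN _ yS).
- exact: fr.
Qed.

Lemma colour_greedily (S : {set V}) (f : V -> C) :
    (forall x, x \in S -> #|[set y | r x y]| < k) -> colours_off S f ->
  exists g, colours_off set0 g.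
Proof.
have [n] := ubnP #|S|; elim: n S f => // n IH S f leSn ltk fS.
have [S0|/set0Pn[x xS]] := eqVneq S set0; first by exists f; rewrite -S0.
have [|g gS] := @colour_vertex S f x _ fS.
  by apply: leq_ltn_trans (ltk x xS); rewrite subset_leq_card ?subsetDl.
apply: (IH (S :\ x) g) => // [|y].
  by rewrite (cardsD1 x S) xS in leSn.
by rewrite inE => /andP[_ /ltk].
Qed.

End GreedyColouring.

Lemma edgesP (G : sgraph) (A : {set G}) :
  reflect (exists x y, adj x y /\ A = [set x; y]) (A \in edges G).
Proof.
apply: (iffP imset2P) => [[x y _]|[x [y [xy ->]]]]; rewrite ?inE.
  by move=> xy ->; exists x, y.
by exists x y; rewrite ?inE.
Qed.

(** * Neighbourhoods in the square and irreducible graphs *)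

Section SquareNeighbourhood.
Variable G : sgraph.

Definition square_nbrs (x : G) : {set G} := [set y | square_adj x y].

Definition light (k : nat) : {set G} := [set x | #|square_nbrs x| < k].

(** A neighbour [u] of [x] accounts for itself and its neighbours other than [x]: [#|neighbours u|]
    vertices, one fewer if [u] lies in [S]. *)
Lemma card_square_nbrsD (x : G) (S : {set G}) :
  #|square_nbrs x :\: S|
    <= \sum_(u in neighbours x) (#|neighbours u| - (u \in S)).
Proof.
pose B u := (u |: neighbours u :\ x) :\: S.
have /subset_leq_card : square_nbrs x :\: S \subset \bigcup_(u in neighbours x) B u.
  apply/subsetP => y; rewrite !inE => /and3P[yS /= xNy].
  case/orP=> [axy|/set0Pn[z]]; first by apply/bigcupP; exists y; rewrite !inE ?eqxx ?yS.
  rewrite !inE => /andP[axz ayz]; apply/bigcupP; exists z; rewrite !inE //.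
  by rewrite yS [adj z y]adj_sym ayz [y == x]eq_sym xNy orbT.
move/leq_trans; apply.
apply: (@leq_trans (\sum_(u in neighbours x) #|B u|)).
  elim/big_ind2: _ => [|S1 n1 S2 n2 h1 h2|//]; first by rewrite cards0.
  by apply: leq_trans (leq_add h1 h2); rewrite cardsU leq_subr.
apply: leq_sum => u; rewrite inE => xu.
have xNu : x \in neighbours u by rewrite inE adj_sym.
have cB : #|u |: neighbours u :\ x| = #|neighbours u|.
  by rewrite cardsU1 !inE adj_irrefl andbF (cardsD1 x (neighbours u)) xNu.
rewrite -cB /B; case: (boolP (u \in S)) => uS.
  rewrite [X in _ <= X - _](cardsD1 u) setU11 addKn subset_leq_card //.
  apply/subsetP => y; rewrite !inE => /andP[yS ->]; rewrite andbT.
  by apply: contraNneq yS => ->.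
by rewrite subn0 subset_leq_card ?subsetDl.
Qed.

Lemma card_square_nbrs (x : G) :
  #|square_nbrs x| <= \sum_(u in neighbours x) #|neighbours u|.
Proof.
rewrite -[square_nbrs x]setD0; apply: leq_trans (card_square_nbrsD x set0) _.
by apply: leq_sum => u _; rewrite leq_subr.
Qed.

(** An upper bound, unlike the exact maximum degree, survives edge deletion with the same [D]. *)
Definition has_bounded_degree (D : nat) := forall x : G, #|neighbours x| <= D.

(* If [uv] violates the second clause, delete it, then recolour [u] first and
   the light vertices last; a pendant vertex can simply be recoloured. *)
Definition irreducible (k : nat) : bool :=
  [forall v : G, #|neighbours v| != 1] &&
  [forall u : G, forall v : G, adj u v ==> (v \in light k) ==>
     (k <= #|square_nbrs u :\: light k|)].

Lemma double_card_edges : \sum_(x : G) #|neighbours x| <= 2 * #|edges G|.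
Proof.
pose arcs := [set p : G * G | adj p.1 p.2].
have -> : \sum_(x : G) #|neighbours x| = #|arcs|.
  rewrite -sum1_card (eq_bigr (fun x => \sum_(y | adj x y) 1)).
    by rewrite pair_big_dep /=; apply: eq_bigl => p; rewrite inE.
  by move=> x _; rewrite sum1dep_card.
pose h (p : G * G) := [set p.1; p.2].
rewrite -sum1_card (partition_big h (mem (edges G))) /=; last first.
  by move=> p; rewrite inE => ap; apply/imset2P; exists p.1 p.2; rewrite ?inE.
rewrite mulnC -sum_nat_const; apply: leq_sum => _ /imset2P[a b _ _ ->].
rewrite sum1dep_card.
apply: (@leq_trans #|[set (a, b); (b, a)]|); last by rewrite cards2; case: eqP.
apply/subset_leq_card/subsetP => -[x y]; rewrite !inE /h /= => /andP[axy /eqP e].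
have xy : x != y by apply: contraTneq axy => ->; rewrite adj_irrefl.
have : x \in [set a; b] by rewrite -e set21.
have : y \in [set a; b] by rewrite -e set22.
rewrite !inE => /orP[] /eqP ey /orP[] /eqP ex; subst; rewrite ?eqxx ?orbT //.
- by rewrite eqxx in xy.
- by rewrite eqxx in xy.
Qed.

End SquareNeighbourhood.

(** * Effect of an edge deletion on the square *)

Section DeleteEdge.
Variables (G : sgraph) (u v : G).

Definition del_adj : rel G := fun x y =>
  adj x y && ([set x; y] != [set u; v]).

Lemma del_adj_sym : symmetric del_adj.
Proof. by move=> x y; rewrite /del_adj adj_sym setUC. Qed.

Lemma del_adj_irrefl : irreflexive del_adj.
Proof. by move=> x; rewrite /del_adj adj_irrefl. Qed.

Definition del_edge : sgraph := SGraph del_adj_sym del_adj_irrefl.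

Lemma del_neighbours_sub (x : G) :
  (neighbours (x : del_edge) : {set G}) \subset neighbours x.
Proof. by apply/subsetP => y; rewrite !inE => /andP[]. Qed.

Lemma del_edges_sub :
  (edges del_edge : {set {set G}}) \subset edges G :\ [set u; v].
Proof.
apply/subsetP => A /(@edgesP del_edge A)[x [y [/andP[xy n] ->]]]; rewrite !inE n.
by apply/edgesP; exists x, y.
Qed.

Lemma del_subgraph (H : {set G} * {set {set G}}) :
  @is_subgraph del_edge H -> is_subgraph H.
Proof.
case/andP=> s1 s2; rewrite /is_subgraph s2 andbT.
exact: subset_trans s1 (subset_trans del_edges_sub (subsetDl _ _)).
Qed.

Lemma del_adjE (x y : G) : x != u -> x != v -> adj x y ->
  @adj del_edge x y && @adj del_edge y x.
Proof.
move=> xu xv xy; rewrite [X in _ && X]adj_sym andbb /= /del_adj xy /=.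
apply/eqP => e; have : x \in [set u; v] by rewrite -e set21.
by rewrite !inE (negPf xu) (negPf xv).
Qed.

Lemma del_square_adj (x y : G) : x \notin [set u; v] -> y \notin [set u; v] ->
  square_adj x y -> @square_adj del_edge x y.
Proof.
rewrite !inE !negb_or => /andP[xu xv] /andP[yu yv] /andP[xy].
rewrite /square_adj xy /=; case/orP=> [axy|/set0Pn[z]].
  by apply/orP; left; case/andP: (del_adjE xu xv axy).
rewrite !inE => /andP[xz yz]; apply/orP; right; apply/set0Pn; exists z.
rewrite in_setI in_set [in X in _ && X]in_set; apply/andP; split.
  by case/andP: (del_adjE xu xv xz).
by case/andP: (del_adjE yu yv yz).
Qed.

(** A pendant [v] is never the middle of a path between distinct vertices, so here the ends may
    include [u]. *)
Lemma del_square_adj_pendant (x y : G) : neighbours v = [set u] ->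
  x != v -> y != v -> square_adj x y -> @square_adj del_edge x y.
Proof.
move=> Nv.
have uvE z : adj z v -> z = u.
  by move=> zv; apply/set1P; rewrite -Nv inE adj_sym.
have keep a b : a != v -> b != v -> adj a b -> @adj del_edge a b.
  move=> av bv ab; rewrite /= /del_adj ab /=.
  apply/eqP => e; have : v \in [set a; b] by rewrite e set22.
  by rewrite !inE ![v == _]eq_sym (negPf av) (negPf bv).
move=> xv yv /andP[xy].
rewrite /square_adj xy /=; case/orP=> [axy|/set0Pn[z]].
  by apply/orP; left; apply: keep.
rewrite !inE => /andP[xz yz]; apply/orP; right; apply/set0Pn; exists z.
have zv : z != v.
  by apply: contraNneq xy => zv; subst z; rewrite (uvE x xz) (uvE y yz).
rewrite !inE; apply/andP; split; exact: keep.
Qed.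

End DeleteEdge.

(** Induction on the number of edges: when [irreducible] fails, an edge is deleted, and the
    adjacencies lost in the square all involve vertices that can be recoloured greedily. *)
Lemma choosable_of_reducible (k : nat) (P : sgraph -> Prop) :
    (forall (G : sgraph) (u v : G), P G -> P (del_edge u v)) ->
    (forall (G : sgraph) (v : G), P G -> #|neighbours v| < k) ->
    (forall (G : sgraph), P G -> irreducible G k -> edges G = set0) ->
    (forall (G : sgraph) (v u : G), P G -> neighbours v = [set u] ->
       #|square_nbrs v| < k) ->
  forall G : sgraph, P G -> choosable (square G) k.
Proof.
move=> Pdel Pk Pirr Ppend G.
have [n] := ubnP #|edges G|; elim: n G => // n IH G leE PG C L hL.
suff [f [fL fc]] : exists f : G -> C, colours_off (@square_adj G) L set0 f.
  by exists f; split=> // x y; apply: fc; rewrite inE.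
have sym := @square_adj_sym G; have irr := @square_adj_irrefl G.
have step u v : adj u v -> exists f : G -> C, (forall x, f x \in L x) /\
    forall x y, @square_adj (del_edge u v) x y -> f x != f y.
  move=> uv; apply: (IH (del_edge u v)) => //; last exact: Pdel.
  have /subset_leq_card le := del_edges_sub u v.
  apply: leq_ltn_trans le _.
  have uvE : [set u; v] \in edges G by apply/edgesP; exists u, v.
  by rewrite (cardsD1 [set u; v]) uvE in leE.
have [/Pirr E0|] := boolP (irreducible G k).
  have hc (x : G) : exists c, c \in L x.
    by apply/card_gt0P/(leq_trans _ (hL x))/(leq_ltn_trans _ (Pk G x PG)).
  have f0 : colours_off (@square_adj G) L setT (fun x => xchoose (hc x)).
    by split=> x; rewrite ?inE //; exact: xchooseP.
  apply: colour_greedily f0 => // x _.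
  apply: leq_ltn_trans (Pk G x PG); rewrite (leq_trans (card_square_nbrs x)) //.
  rewrite big1 // => y; rewrite inE => xy.
  have : [set x; y] \in edges G by apply/edgesP; exists x, y.
  by rewrite E0 // inE.
rewrite negb_and !negb_forall => /orP[]/existsP[].
  move=> v; rewrite negbK => /cards1P[u Nv].
  have uv : adj u v by rewrite adj_sym; have := set11 u; rewrite -Nv inE.
  have [f [fL fc]] := step u v uv.
  have f0 : colours_off (@square_adj G) L [set v] f.
    split=> // x y; rewrite !inE => xv yv xy; apply: fc.
    exact: del_square_adj_pendant.
  by apply: colour_greedily f0 => // x /set1P ->; apply: Ppend Nv.
move=> u; rewrite negb_forall => /existsP[v].
rewrite !negb_imply -ltnNge => /and3P[uv vl ltk].
have [f [fL fc]] := step u v uv.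
have f0 : colours_off (@square_adj G) L (u |: light G k) f.
  split=> // x y; rewrite !in_setU1 !negb_or.
  move=> /andP[xu xl] /andP[yu yl] xy; apply: fc.
  apply: del_square_adj => //; rewrite !inE negb_or ?xu ?yu /=.
    by apply: contraNneq xl => ->.
  by apply: contraNneq yl => ->.
have [|g g0] := @colour_vertex _ _ _ L k sym irr hL _ f u _ f0.
  apply: leq_ltn_trans ltk; apply/subset_leq_card/subsetP => y.
  rewrite !inE negb_or => /andP[/andP[_ ->]] ->; by [].
have [] := @colour_greedily _ _ _ L k sym irr hL _ g _ g0.
  by move=> x; rewrite !inE; case: eqP.
by move=> g' ?; exists g'.
Qed.

Local Open Scope ring_scope.

(** * Discharging on irreducible graphs *)

Section Discharging.
Variables (R : realType) (G : sgraph) (c eps : R) (k D : nat).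
Hypotheses (hc : 3 <= c) (heps0 : 0 < eps) (heps1 : eps < 4 / (c * (c + 1))).
Hypotheses (hkD : D%:R + c < k.+1%:R) (hkT : 16 * c ^+ 2 * eps ^- 2 < k.+1%:R).
Hypotheses (degG : has_bounded_degree G D) (irrG : irreducible G k).

Local Notation deg x := #|neighbours x|.
Local Notation degr x := (#|neighbours x|%:R : R).

(** [m] is the charge each non-isolated vertex must reach. A big vertex keeps at least [q] per edge,
    and [T * q = 4] exceeds [m]; [T * T] is the second term of the bound. *)
Let T := 4 * c / eps.
Let m : R := 4 - 4 / (c + 1) - eps.
Let a := 2 / (c + 1).
Let q := eps / c.

Definition big_nbrs (thr : R) (x : G) : {set G} :=
  [set u in neighbours x | thr <= degr u].

Let big (x : G) := T <= degr x.
Let h (x : G) := #|big_nbrs T x|.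
(* What a vertex with exactly one big neighbour asks from its other neighbours. *)
Let psi (v : G) : R :=
  if ~~ big v && (h v == 1)%N then Num.max 0 (1 - a * degr v) else 0.
Let poor (u : G) := (u \in light G k) && (0 < psi u).
(* The charge sent along the edge from [u] to [v]. A small [u] without big
   neighbours splits its excess over [m] equally; its gift is negative when
   [deg u] is 2 or 3. Poor vertices must be exempted from giving: their
   neighbours are not light, so they may all be small vertices that still ask. *)
Let gift (u v : G) : R :=
  if big u then 1 - q
  else if h u == 0%N then 1 - m / degr u
  else if poor u then 0 else psi v.
(* The share of the edge [uv] that ends up at [v]: [tau v u + tau u v = 2]. *)
Let tau (v u : G) : R := 1 + gift u v - gift v u.

Let c_neq0 : c != 0.
Proof. by rewrite gt_eqF //; have := hc; lra. Qed.
Let c1_neq0 : c + 1 != 0.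
Proof. by rewrite gt_eqF //; have := hc; lra. Qed.
Let eps_neq0 : eps != 0.
Proof. by rewrite gt_eqF. Qed.

(** Equivalently [a * (c - 1) = 2 - 2 * a], which is what a small vertex with one big neighbour
    needs from its other edges. *)
Let ac : a * c = 2 - a.
Proof. by rewrite /a; field; rewrite ?c_neq0 ?c1_neq0 ?eps_neq0. Qed.
Let a0 : 0 < a.
Proof. by rewrite divr_gt0 //; have := hc; lra. Qed.
Let a1 : 2 * a <= 1.
Proof. by have := ac; have := a0; have := hc; nra. Qed.
Let qc : q * c = eps.
Proof. by rewrite /q; field; rewrite ?c_neq0 ?c1_neq0 ?eps_neq0. Qed.
Let q0 : 0 < q.
Proof. by rewrite divr_gt0 //; have := hc; lra. Qed.
Let q3 : 3 * q <= eps.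
Proof. by rewrite -qc; have := q0; have := hc; nra. Qed.
Let mE : m = 4 - 2 * a - eps.
Proof. by rewrite /m /a; field; rewrite ?c_neq0 ?c1_neq0 ?eps_neq0. Qed.
Let epsc : eps * c < 2 * a.
Proof.
have -> : 2 * a = 4 / (c * (c + 1)) * c.
  by rewrite /a; field; rewrite c_neq0 c1_neq0.
by rewrite ltr_pM2r //; have := hc; lra.
Qed.
Let eps_small : eps < 1 / 3.
Proof. by have := epsc; have := a1; have := hc; have := heps0; nra. Qed.
Let Tq : T * q = 4.
Proof. by rewrite /T /q; field; rewrite ?c_neq0 ?c1_neq0 ?eps_neq0. Qed.
Let Tc : c + 1 <= T.
Proof.
have := epsc; have := ac; have := a0; have := qc; have := Tq; have := q0; have := hc.
move=> hc' q0' Tq' qc' a0' ac' epsc'.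
have h1 : q * c * c < 2 * a by rewrite qc'.
rewrite -(ler_pM2r q0') Tq'; nra.
Qed.
Let kT : T * T < k.+1%:R.
Proof.
suff -> : T * T = 16 * c ^+ 2 * eps ^- 2 by exact: hkT.
by rewrite /T; field.
Qed.

Let deg_neq1 (v : G) : deg v != 1%N.
Proof. by case/andP: irrG => /forallP. Qed.

Let light_nbr (u v : G) : adj u v -> v \in light G k ->
  (k <= #|square_nbrs u :\: light G k|)%N.
Proof.
case/andP: irrG => _ /forallP/(_ u)/forallP/(_ v)/implyP h1 /h1/implyP; exact.
Qed.

Let light_stable (u v : G) : adj u v -> v \in light G k -> u \notin light G k.
Proof.
move=> uv vl; rewrite inE -leqNgt (leq_trans (light_nbr uv vl)) //.
by rewrite subset_leq_card ?subsetDl.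
Qed.

Let deg_ge2 (u v : G) : u \in neighbours v -> 2 <= degr u.
Proof.
rewrite inE adj_sym => uv; rewrite ler_nat.
have := deg_neq1 u; have : (0 < deg u)%N by apply/card_gt0P; exists v; rewrite inE.
by case: (deg u) => [|[]].
Qed.

Let h_gt0 (u v : G) : u \in neighbours v -> big u -> h v != 0%N.
Proof. by move=> uv bu; rewrite -lt0n; apply/card_gt0P; exists u; rewrite inE uv. Qed.

Let card_square_nbrs0 (x : G) : h x = 0%N -> (#|square_nbrs x|%:R : R) <= degr x * T.
Proof.
move=> hx; apply: (@le_trans _ _ (\sum_(u in neighbours x) degr u)).
  by rewrite -natr_sum ler_nat card_square_nbrs.
rewrite -sum1_card natr_sum mulr_suml; apply: ler_sum => u ux; rewrite mul1r.
rewrite leNgt; apply/negP => Tu; have := @h_gt0 u x ux (ltW Tu).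
by rewrite hx.
Qed.

(** The square degree is at most [c * T <= T * T - T], which is below [k]. *)
Let light0 (x : G) : h x = 0%N -> degr x <= c -> x \in light G k.
Proof.
move=> hx dc; rewrite inE -(ltr_nat R).
have := card_square_nbrs0 hx; have := kT; rewrite -natr1; have := Tc.
have : 0 <= degr x by rewrite ler0n.
nra.
Qed.

Let square_nbrs_le (x : G) : ~~ big x -> h x = 0%N -> (#|square_nbrs x| <= k)%N.
Proof.
move=> bx hx; rewrite -ltnS -(ltr_nat R).
have := card_square_nbrs0 hx; have := kT; have := Tc.
move: bx; rewrite /big -ltNge; have : 0 <= degr x by rewrite ler0n.
nra.
Qed.

(** Otherwise [u] has at most [k] neighbours in the square; one of them is the light [v], leaving
    fewer than the [k] non-light ones that irreducibility demands. *)
Let light_nbr_h (u v : G) : adj u v -> ~~ big u -> v \in light G k -> h u != 0%N.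
Proof.
move=> uv bu vl; apply/eqP => hu.
have := light_nbr uv vl; apply/negP; rewrite -ltnNge.
apply: leq_trans (square_nbrs_le bu hu).
rewrite [X in (_ < X)%N](cardsD1 v) [v \in _]inE.
have -> : square_adj u v.
  by rewrite /square_adj uv andbT; apply: contraTneq uv => ->; rewrite adj_irrefl.
rewrite ltnS subset_leq_card //; apply/subsetP => y; rewrite !inE => /andP[yl ->].
by rewrite andbT; apply: contraNneq yl => ->; move: vl; rewrite inE.
Qed.

Let psi_ge0 v : 0 <= psi v.
Proof. by rewrite /psi; case: ifP => // _; rewrite le_max lexx. Qed.

Let psi_le v : 2 <= degr v -> psi v <= 1 - 2 * a.
Proof.
rewrite /psi => d2; have := a0; have := a1 => a1' a0'.
case: ifP => _; last by lra.
by rewrite ge_max; apply/andP; split; nra.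
Qed.

Let psi_big v : big v -> psi v = 0.
Proof. by rewrite /psi => ->. Qed.

Let psi0 v : h v != 1%N -> psi v = 0.
Proof. by rewrite /psi => /negPf ->; rewrite andbF. Qed.

Let psi_low v : ~~ big v -> h v = 1%N -> 1 - a * degr v <= psi v.
Proof. by rewrite /psi => -> ->; rewrite le_max lexx orbT. Qed.

Let gift_ge0 u v : big u || (h u != 0%N) -> 0 <= gift u v.
Proof.
rewrite /gift; case: ifP => [_ _|_ /= /negPf ->].
  by have := eps_small; have := q3; have := heps0; lra.
by case: ifP.
Qed.

Let gift_le u v : ~~ big u -> h u != 0%N -> gift u v <= psi v.
Proof. by rewrite /gift => /negPf -> /negPf ->; case: ifP. Qed.

Let gift0_ge u v : ~~ big u -> h u = 0%N -> gift u v = 1 - m / degr u.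
Proof. by rewrite /gift => /negPf -> ->. Qed.

Let low_nbrs x := neighbours x :\: big_nbrs T x.

Let low_nbrsP u x : reflect (u \in neighbours x /\ ~~ big u) (u \in low_nbrs x).
Proof.
apply: (iffP setDP) => -[uN]; rewrite [u \in big_nbrs _ _]inE uN -/(big u) //.
Qed.

Let sum_low (F : G -> R) x : \sum_(u in neighbours x) F u =
  \sum_(u in big_nbrs T x) F u + \sum_(u in low_nbrs x) F u.
Proof.
rewrite (big_setID (big_nbrs T x)) /=; congr (_ + _); apply: eq_bigl => u.
by rewrite !inE; case: adj.
Qed.

Let card_low x : (#|low_nbrs x| + h x)%N = deg x.
Proof.
rewrite addnC -(cardsID (big_nbrs T x) (neighbours x)); congr (_ + _)%N.
by apply: eq_card => u; rewrite !inE; case: adj.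
Qed.

Let sum_ge (A : {set G}) (F : G -> R) (b : R) :
  (forall u, u \in A -> b <= F u) -> #|A|%:R * b <= \sum_(u in A) F u.
Proof.
move=> hb; rewrite -sum1_card natr_sum mulr_suml; apply: ler_sum => u uA.
by rewrite mul1r hb.
Qed.

Let charge_big v : big v -> m <= \sum_(u in neighbours v) tau v u.
Proof.
move=> bv; apply: (@le_trans _ _ (degr v * q)).
  have : T * q <= degr v * q by rewrite ler_pM2r.
  by rewrite Tq; have := mE; have := a0; have := heps0; lra.
apply: sum_ge => u uv; rewrite /tau {2}/gift bv.
have : 0 <= gift u v.
  apply: gift_ge0; apply/orP; right; apply: (@h_gt0 v) => //.
  by move: uv; rewrite !inE adj_sym.
lra.
Qed.

(** The part of each edge that [v] keeps adds up to [m], so no gift to [v] may be negative. A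
    negative gift would need a neighbour of degree at most 3 without big neighbours; it would be
    light, forcing a big neighbour on [v]. *)
Let charge0 v : (0 < deg v)%N -> ~~ big v -> h v = 0%N ->
  m <= \sum_(u in neighbours v) tau v u.
Proof.
move=> d0 bv hv; apply: (@le_trans _ _ (degr v * (m / degr v))).
  by rewrite mulrCA divff ?mulr1 // pnatr_eq0 -lt0n.
apply: sum_ge => u uv; rewrite /tau [gift v u]gift0_ge //.
suff : 0 <= gift u v by lra.
have bu : ~~ big u by apply/negP => /(h_gt0 uv); rewrite hv.
have [hu|hu] := eqVneq (h u) 0%N; last by apply: gift_ge0; rewrite hu orbT.
rewrite gift0_ge // subr_ge0.
have du : 0 < degr u by have := deg_ge2 uv; lra.
rewrite ler_pdivrMr // mul1r.
suff : 4 <= degr u by have := mE; have := a0; have := heps0; lra.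
rewrite leNgt (ltr_nat _ _ 4) ltnS; apply/negP => d3.
have ul : u \in light G k.
  by apply: light0 => //; apply: le_trans hc; rewrite (ler_nat _ _ 3).
have vu : adj v u by move: uv; rewrite inE.
by have := light_nbr_h vu bv ul; rewrite hv.
Qed.

Let tau_big v u : u \in neighbours v -> ~~ big v -> big u -> tau v u = 2 - q.
Proof.
move=> uv bv bu; rewrite /tau /gift bu (negPf bv) (negPf (h_gt0 uv bu)).
by rewrite psi_big // if_same; lra.
Qed.

(** Two big neighbours already bring [4 - 2 * q >= m], and no other edge costs anything. *)
Let charge2 v : ~~ big v -> (2 <= h v)%N -> m <= \sum_(u in neighbours v) tau v u.
Proof.
move=> bv hv; rewrite sum_low.
have h0 : h v != 0%N by case: (h v) hv.
have b1 : (h v)%:R * (2 - q) <= \sum_(u in big_nbrs T v) tau v u.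
  by apply: sum_ge => u; rewrite inE => /andP[uv bu]; rewrite tau_big.
have b2 : 0 <= \sum_(u in low_nbrs v) tau v u.
  apply: sumr_ge0 => u /low_nbrsP[uv bu]; rewrite /tau.
  have := gift_le u bv h0; have := psi_le (deg_ge2 uv); have := a0.
  have [hu|hu] := eqVneq (h u) 0%N; last first.
    have : 0 <= gift u v by apply: gift_ge0; rewrite hu orbT.
    by lra.
  rewrite [gift u v]gift0_ge //.
  have : m / degr u <= 2.
    by rewrite ler_pdivrMr; have := deg_ge2 uv; have := mE; have := heps0; have := a0; lra.
  by rewrite [psi u]psi0 ?hu //; lra.
have : 2 * (2 - q) <= (h v)%:R * (2 - q).
  by rewrite ler_pM2r ?ler_nat //; have := q3; have := eps_small; lra.
by have := mE; have := q3; have := q0; have := a0; lra.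
Qed.

(** * Small vertices with exactly one big neighbour *)

Section OneBigNeighbour.
Variable v : G.
Hypotheses (bv : ~~ big v) (hv : h v = 1%N) (dv : 2 <= degr v).

Let low_deg : #|low_nbrs v|%:R = degr v - 1.
Proof. by rewrite -(card_low v) hv natrD addrK. Qed.

Let gift_v u : gift v u <= psi u.
Proof. by apply: gift_le; rewrite // hv. Qed.

Let tau_h0 u : u \in low_nbrs v -> h u = 0%N -> 2 - m / degr u <= tau v u.
Proof.
move=> /low_nbrsP[uv bu] hu; rewrite /tau [gift u v]gift0_ge //.
by have := gift_v u; rewrite psi0 ?hu //; lra.
Qed.

Let tau_h1 u : u \in low_nbrs v -> h u != 0%N -> 1 - psi u <= tau v u.
Proof.
move=> /low_nbrsP[uv bu] hu; rewrite /tau.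
have : 0 <= gift u v by apply: gift_ge0; rewrite hu orbT.
by have := gift_v u; lra.
Qed.

Let tau_ge u : u \in low_nbrs v -> a <= tau v u.
Proof.
move=> uv; have d2 : 2 <= degr u by case/low_nbrsP: uv => /deg_ge2.
have [hu|hu] := eqVneq (h u) 0%N.
  apply: le_trans (tau_h0 uv hu).
  have : m / degr u <= 2 - a; last by lra.
  by rewrite ler_pdivrMr; have := mE; have := heps0; have := a1; nra.
apply: le_trans (tau_h1 uv hu).
by have := psi_le d2; have := a0; lra.
Qed.

(* One generous neighbour suffices, the [deg v - 2] others giving at least [a]. *)
Let rich_nbr y : y \in low_nbrs v -> 2 - a * degr v <= tau v y ->
  2 - 2 * a <= \sum_(u in low_nbrs v) tau v u.
Proof.
move=> yv ty; rewrite (big_setD1 y) //=.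
have : #|low_nbrs v :\ y|%:R * a <= \sum_(u in low_nbrs v :\ y) tau v u.
  by apply: sum_ge => u; rewrite in_setD1 => /andP[_ /tau_ge].
have : 1 + #|low_nbrs v :\ y|%:R = degr v - 1.
  by rewrite -low_deg (cardsD1 y (low_nbrs v)) yv natrD.
set n := #|_ :\ _|%:R => n1; have -> : n = degr v - 2 by lra.
lra.
Qed.

(** Since [2 * a * c = 4 - 2 * a >= m], a degree above [c] makes [m / degr y] at most [2 * a]. *)
Let large_h0 y : y \in low_nbrs v -> h y = 0%N -> c < degr y ->
  2 - 2 * a <= \sum_(u in low_nbrs v) tau v u.
Proof.
move=> yv hy dy; apply: (rich_nbr yv); apply: le_trans (tau_h0 yv hy).
have : m / degr y <= 2 * a.
  have : 0 < a * (degr y - c) by rewrite mulr_gt0 ?subr_gt0.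
  by rewrite ler_pdivrMr; have := mE; have := heps0; have := ac; have := hc; lra.
have : 0 <= a * (degr v - 2) by rewrite mulr_ge0 ?subr_ge0 // ltW.
lra.
Qed.

Let nonpoor_nbr y : y \in low_nbrs v -> h y != 0%N -> ~~ poor y -> gift v y = 0 ->
  2 - 2 * a <= \sum_(u in low_nbrs v) tau v u.
Proof.
move=> yv hy py gy; apply: (rich_nbr yv); rewrite /tau gy.
case/low_nbrsP: yv => yv bY; rewrite /gift (negPf bY) (negPf hy) (negPf py).
by have := psi_low bv hv; lra.
Qed.

Let adj_low u : u \in low_nbrs v -> adj v u.
Proof. by case/low_nbrsP; rewrite inE. Qed.

(** No neighbour of a light [v] is light, hence none is poor, and one without big neighbours has
    degree above [c]. If all have big neighbours, either [v] is poor and gives them nothing, or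
    [a * degr v >= 1] and [2 * a] per edge suffices. *)
Let light_low_sum : v \in light G k -> 2 - 2 * a <= \sum_(u in low_nbrs v) tau v u.
Proof.
move=> vl.
have nl u : u \in low_nbrs v -> u \notin light G k.
  by move=> /adj_low; rewrite adj_sym => uv; apply: light_stable uv vl.
have [/exists_inP[y yv /eqP hy]|] := boolP [exists (y | y \in low_nbrs v), h y == 0%N].
  apply: (large_h0 yv hy); rewrite ltNge; apply/negP => /(light0 hy).
  by apply/negP; apply: nl.
rewrite negb_exists_in => /forall_inP hl.
have [pv|pv] := boolP (poor v).
  have /card_gt0P[y yv] : (0 < #|low_nbrs v|)%N.
    by rewrite -(ltr0n R) low_deg; have := dv; lra.
  apply: (nonpoor_nbr yv); [exact: hl | by rewrite /poor (negPf (nl y yv)) |].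
  by rewrite /gift (negPf bv) hv pv.
have : 1 <= a * degr v.
  have := psi_low bv hv; move: pv; rewrite /poor vl /= -leNgt; lra.
have : #|low_nbrs v|%:R * (2 * a) <= \sum_(u in low_nbrs v) tau v u.
  apply: sum_ge => u uv; apply: le_trans (tau_h1 uv (hl u uv)).
  have d2 : 2 <= degr u by case/low_nbrsP: uv => /deg_ge2.
  by have := psi_le d2; lra.
by rewrite low_deg; lra.
Qed.

Let card_square_nbrs1 (S : {set G}) :
  (#|square_nbrs v :\: S| <= D + \sum_(u in low_nbrs v) (deg u - (u \in S)))%N.
Proof.
apply: leq_trans (card_square_nbrsD v S) _.
have /cards1P[z hz] : #|big_nbrs T v| == 1%N by apply/eqP.
rewrite (big_setID (big_nbrs T v)) /= leq_add //.
rewrite (eq_bigl (mem [set z])); last first.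
  by move=> u; rewrite -hz !inE; case: adj.
by rewrite big_set1 (leq_trans (leq_subr _ _)).
Qed.

Let heavy_low_sum : v \notin light G k -> 2 - 2 * a <= \sum_(u in low_nbrs v) tau v u.
Proof.
move=> vl.
have [/exists_inP[y yv /andP[/eqP hy dy]]|] :=
    boolP [exists (y | y \in low_nbrs v), (h y == 0%N) && (c < degr y)].
  exact: large_h0 dy.
rewrite negb_exists_in => /forall_inP hl0.
have [/exists_inP[y yv /andP[hy /eqP py]]|] :=
    boolP [exists (y | y \in low_nbrs v), (h y != 0%N) && (psi y == 0)].
  apply: (nonpoor_nbr yv hy); first by rewrite /poor py ltxx andbF.
  by rewrite /gift (negPf bv) hv py if_same.
rewrite negb_exists_in => /forall_inP hl1.
have hl0' u : u \in low_nbrs v -> h u = 0%N -> degr u <= c.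
  by move=> uv hu; have := hl0 u uv; rewrite hu eqxx /= -leNgt.
(* Here [psi u] is nonzero, so it equals [1 - a * degr u]. *)
have tau1 u : u \in low_nbrs v -> h u != 0%N -> a * degr u <= tau v u.
  move=> uv hu; apply: le_trans (tau_h1 uv hu).
  have := hl1 u uv; rewrite hu /= => pu.
  suff : psi u <= 1 - a * degr u by lra.
  move: pu; rewrite /psi; case: ifP => _; last by rewrite eqxx.
  by rewrite maxElt; case: ifP => //; rewrite eqxx.
(* Each edge to [u] is worth [a] times the number of vertices outside [S] that
   [v] sees through [u]; these numbers add up to at least [k - D > c - 1]. *)
suff [S kS tauS] : exists2 S, (k <= #|square_nbrs v :\: S|)%N &
    forall u, u \in low_nbrs v -> a * (deg u - (u \in S))%:R <= tau v u.
  have : a * (k%:R - D%:R) <= \sum_(u in low_nbrs v) tau v u.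
    apply: (@le_trans _ _ (a * (\sum_(u in low_nbrs v) (deg u - (u \in S)))%:R)).
      rewrite ler_pM2l // lerBlDl -natrD ler_nat.
      exact: leq_trans kS (card_square_nbrs1 S).
    by rewrite natr_sum mulr_sumr; apply: ler_sum.
  have := hkD; rewrite -natr1; have := ac; have := a0; nra.
(* With a light neighbour, irreducibility bounds the non-light vertices seen from [v], and [S]
   discounts the light [u]. With none, [v] being non-light gives the count for empty [S], and every
   low [u] has a big neighbour. *)
have [/exists_inP[y yv yl]|] := boolP [exists (y | y \in neighbours v), y \in light G k].
  exists (light G k); first by move: yv; rewrite inE => vy; apply: light_nbr yl.
  move=> u uv; have [hu|hu] := eqVneq (h u) 0%N; last first.
    by apply: le_trans (tau1 u uv hu); rewrite ler_pM2l // ler_nat leq_subr.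
  have dc := hl0' u uv hu; rewrite (light0 hu dc) -[nat_of_bool true]/1%N.
  have d2 : 2 <= degr u by case/low_nbrsP: uv => /deg_ge2.
  apply: le_trans (tau_h0 uv hu).
  rewrite natrB; last by rewrite -(ler_nat R); lra.
  suff : m / degr u <= 2 - a * (degr u - 1) by lra.
  rewrite ler_pdivrMr; last by lra.
  (* With [m + eps] for [m], the required inequality is quadratic in [degr u], with equality at 2
     and [c]. *)
  have : 0 <= a * ((degr u - 2) * (c - degr u)).
    by apply: mulr_ge0; [exact: ltW | apply: mulr_ge0; rewrite subr_ge0].
  have := mE; have := ac; have := heps0; move: (degr u) => x eps_gt0 ac' -> pos.
  have : a * c * x = (2 - a) * x by rewrite ac'.
  lra.
rewrite negb_exists_in => /forall_inP nl.
exists set0; first by rewrite setD0 leqNgt; move: vl; rewrite inE.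
move=> u uv; rewrite in_set0 subn0; apply: tau1 => //.
apply/eqP => hu; have := light0 hu (hl0' u uv hu).
by apply/negP/nl; case/low_nbrsP: uv.
Qed.

Lemma charge1 : m <= \sum_(u in neighbours v) tau v u.
Proof.
rewrite sum_low.
have b1 : (h v)%:R * (2 - q) <= \sum_(u in big_nbrs T v) tau v u.
  by apply: sum_ge => u; rewrite inE => /andP[uv bu]; rewrite tau_big.
have b2 : 2 - 2 * a <= \sum_(u in low_nbrs v) tau v u.
  by have [/light_low_sum|/heavy_low_sum] := boolP (v \in light G k).
by rewrite hv in b1; have := mE; have := q3; have := heps0; lra.
Qed.

End OneBigNeighbour.

(** * Total charge and the choice number *)

Let sum_tau : \sum_(v : G) \sum_(u in neighbours v) tau v u = \sum_(v : G) degr v.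
Proof.
rewrite /tau; under eq_bigr do rewrite sumrB big_split /= sumr_const.
rewrite sumrB big_split /=.
have -> : \sum_(v : G) \sum_(u in neighbours v) gift v u =
    \sum_(v : G) \sum_(u in neighbours v) gift u v.
  rewrite (exchange_big_dep xpredT) //=; apply: eq_bigr => v _.
  by apply: eq_bigl => u; rewrite !inE adj_sym.
by rewrite addrK.
Qed.

(** Gifts cancel in the total, which is the degree sum. Isolated vertices receive no charge and are
    therefore left out. *)
Lemma irreducible_dense :
  (4 - 4 / (c + 1) - eps) * #|[set v : G | neighbours v != set0]|%:R
    <= 2 * #|edges G|%:R :> R.
Proof.
apply: (@le_trans _ _ (\sum_(v : G) degr v)); last first.
  by rewrite -natr_sum -natrM ler_nat double_card_edges.
rewrite -sum_tau (bigID (mem [set v : G | neighbours v != set0])) /=.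
rewrite [X in _ <= X]addrC big1 ?add0r; last first.
  by move=> v; rewrite inE negbK => /eqP ->; rewrite big_set0.
rewrite mulrC; apply: sum_ge => v; rewrite inE -card_gt0 => d0.
have [bv|bv] := boolP (big v); first exact: charge_big.
have [h0|] := eqVneq (h v) 0%N; first exact: charge0.
case hv: (h v) => [|[|n]] // _; last by apply: charge2; rewrite // hv.
apply: charge1 => //; rewrite ler_nat.
by have := deg_neq1 v; case: (deg v) d0 => [|[]].
Qed.

End Discharging.

Lemma choosable_sparse_square (R : realType) (c eps : R) (k D : nat) (G : sgraph) :
    3 <= c -> 0 < eps -> eps < 4 / (c * (c + 1)) ->
    D%:R + c < k.+1%:R -> 16 * c ^+ 2 * eps ^- 2 < k.+1%:R ->
    has_bounded_degree G D ->
    (forall H : {set G} * {set {set G}}, is_subgraph H -> H.1 != set0 ->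
       2 * #|H.2|%:R < (4 - 4 / (c + 1) - eps) * #|H.1|%:R) ->
  choosable (square G) k.
Proof.
move=> hc heps0 heps1 hkD hkT degG sparseG.
have ltDk : (D < k)%N by rewrite -ltnS -(ltr_nat R) -natr1; lra.
pose P (G : sgraph) := has_bounded_degree G D /\
    forall H : {set G} * {set {set G}}, is_subgraph H -> H.1 != set0 ->
       2 * #|H.2|%:R < (4 - 4 / (c + 1) - eps) * #|H.1|%:R.
apply: (@choosable_of_reducible k P) => // {G degG sparseG}.
- move=> G u v [degG sparseG]; split=> [x|H /del_subgraph]; last exact: sparseG.
  exact: leq_trans (subset_leq_card (del_neighbours_sub u v x)) (degG x).
- by move=> G v [degG _]; apply: leq_ltn_trans ltDk.
- move=> G [degG sparseG] irrG; apply/eqP/negPn/negP => /set0Pn[A AG].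
  (* All edges on the non-isolated vertices form a subgraph violating sparsity; the edge [A] makes
     it non-empty. *)
  have := irreducible_dense hc heps0 heps1 hkD hkT degG irrG.
  apply/negP; rewrite -ltNge.
  apply: (sparseG ([set v | neighbours v != set0], edges G)).
    rewrite /is_subgraph subxx /=; apply/forall_inP => _ /edgesP[x [y [xy ->]]].
    by apply/subsetP => z; rewrite !inE => /orP[]/eqP ->; apply/set0Pn;
      [exists y; rewrite inE | exists x; rewrite inE adj_sym].
  have [x [y [xy _]]] := edgesP _ AG.
  by apply/set0Pn; exists x; rewrite inE; apply/set0Pn; exists y; rewrite inE.
- move=> G v u [degG _] Nv; apply: leq_ltn_trans (card_square_nbrs v) _.
  by rewrite Nv big_set1; apply: leq_ltn_trans ltDk.
Qed.

Theorem theorem1 (R : realType) (c : R) (hc : 3 <= c) (G : sgraph) (eps : R)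
    (heps0 : 0 < eps) (heps1 : eps < 4 / (c * (c + 1)))
    (hmad : mad R G < 4 - 4 / (c + 1) - eps) :
  (choice_number (square G))%:R
    <= Num.max ((max_degree G)%:R + c) (16 * c ^+ 2 * eps ^- 2).
Proof.
set M := Num.max _ _.
have M0 : 0 <= M by rewrite le_max addr_ge0 ?ler0n //; lra.
(* With [k] the truncation of [M], [k <= M] serves the conclusion and [M < k.+1] both numerical
   hypotheses. *)
have /andP[kM Mk] := truncn_itv M0.
suff ck : choosable (square G) (Num.truncn M).
  apply: le_trans kM; rewrite ler_nat /choice_number; case: ex_minnP => n _.
  by apply; apply/asboolP.
have := Mk; rewrite {1}/M gt_max => /andP[MD MT].
apply: choosable_sparse_square hc heps0 heps1 MD MT _ _.
  by move=> x; apply: (leq_bigmax (F := fun x : G => #|neighbours x|)).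
move=> H sH H0.
rewrite -ltr_pdivrMr; last by rewrite ltr0n card_gt0.
apply: le_lt_trans hmad.
rewrite /mad; pose avg (H : {set G} * {set {set G}}) : R := 2 * #|H.2|%:R / #|H.1|%:R.
by apply: (le_bigmax_cond _ avg); rewrite sH.
Qed.
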